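(* Let $\alpha=(\alpha_0,\ldots,\alpha_{n-1})\in Q_{n,2^n}$ with $\alpha_0<\cdots<\alpha_{n-1}$, and let $A=\mathbf{P}_{2^n}[\alpha]$ be the induced poset matrix of the binary Pascal matrix. Then the dual matrix $A^*$ is the poset matrix given by $A^*=\mathbf{P}_{2^n}[\beta]$, where $$\beta=(\bar{\alpha}_{n-1},\ldots,\bar{\alpha}_0)\in Q_{n,2^n},\qquad \bar{\alpha}_i=(2^n-1)-\alpha_i,\quad 0\le i\le n-1.$$
   Context: $Q_{n,2^n}$ is the collection of $n$-element subsets of $\{0,1,\ldots,2^n-1\}$, written as vectors. The binary Pascal matrix $\mathbf{P}_{2^n}$ is the $2^n\times2^n$ $(0,1)$-matrix with $(\mathbf{P}_{2^n})_{i,j}\equiv\binom{i}{j}\pmod 2$, $0\le i,j\le 2^n-1$; $\mathbf{P}_{2^n}[\alpha]$ is the $n\times n$ matrix with $(i,j)$ entry $(\mathbf{P}_{2^n})_{\alpha_i,\alpha_j}$. A poset matrix is an $n\times n$ $(0,1)$-matrix $A=[a_{ij}]_{0\le i,j\le n-1}$ that is lower triangular with unit diagonal and transitive ($a_{ij}=1$ and $a_{jk}=1$ imply $a_{ik}=1$). The dual matrix of $A$ is its flip transpose $A^*=E_nA^TE_n$, where $E_n$ is the $n\times n$ anti-diagonal permutation matrix; explicitly $(A^* )_{i,j}=a_{n-1-j,\,n-1-i}$ for $0\le i,j\le n-1$. (It is the poset matrix of the dual poset after relabelling $i\mapsto n-1-i$.) *)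

(* Defs.v *)
From mathcomp Require Import all_boot all_order all_algebra.

Set Implicit Arguments.
Unset Strict Implicit.
Unset Printing Implicit Defensive.

Import GRing.Theory Num.Theory.
Local Open Scope ring_scope.

(* The k-element subsets of {0, ..., m-1}, each written as the vector of its
   elements in increasing order. *)
Definition Q (k m : nat) : {set k.-tuple 'I_m} :=
  [set a : k.-tuple 'I_m | sorted ltn [seq val x | x <- a]].

Definition binary_pascal_mx (m : nat) : 'M[int]_m :=
  \matrix_(i < m, j < m) ('C(i, j) %% 2)%N%:Z.

Definition principal_submx (m k : nat) (P : 'M[int]_m) (a : k.-tuple 'I_m) :
    'M[int]_k :=
  mxsub (tnth a) (tnth a) P.

(* [is_trig_mx A] is lower triangularity: A i j = 0 whenever i < j. *)
Definition is_poset_mx (n : nat) (A : 'M[int]_n) : Prop :=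
  [/\ forall i j, A i j = 0 \/ A i j = 1,
      is_trig_mx A,
      forall i, A i i = 1
    & forall i j k, A i j = 1 -> A j k = 1 -> A i k = 1].

(* [rev_ord i] is (n - 1) - i for i : 'I_n. *)
Definition antidiag_mx (n : nat) : 'M[int]_n :=
  \matrix_(i < n, j < n) (j == rev_ord i)%:R.

Definition dual_mx (n : nat) (A : 'M[int]_n) : 'M[int]_n :=
  antidiag_mx n *m A^T *m antidiag_mx n.

(* The vector (m-1-a_(k-1), ..., m-1-a_0): the inner [rev_ord] reverses the
   positions in 'I_k, the outer one complements the entries in 'I_m. *)
Definition rev_compl (k m : nat) (a : k.-tuple 'I_m) : k.-tuple 'I_m :=
  [tuple rev_ord (tnth a (rev_ord i)) | i < k].

(* Main.v *)
Require Import Defs.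
From mathcomp Require Import all_boot all_order all_algebra.
From mathcomp Require Import zify.

(** By Lucas' theorem modulo 2, ['C(i, j)] is odd exactly when every binary
    digit of [j] is at most the corresponding digit of [i].  Replacing [i] by
    [2 ^ n - 1 - i] complements all [n] digits and so reverses this order,
    which is the claimed duality. *)

Import GRing.Theory.
Local Open Scope ring_scope.

(** The two parities are proved together: applying Pascal's rule twice expresses each in the next
    row through both in the current one, and equal terms cancel modulo 2. *)
Lemma odd_bin_double (a b : nat) :
  odd 'C(a.*2, b.*2) = odd 'C(a, b) /\ odd 'C(a.*2, b.*2.+1) = false.
Proof.
elim: a b => [|a IHa] [|b] //; first by rewrite !bin0 bin1 odd_double.
have [[IH0 IH1] [IHb0 IHb1]] := (IHa b.+1, IHa b).
rewrite !doubleS !binS !oddD -!doubleS IH0 IH1 IHb0 IHb1.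
by rewrite addbF addFb addbb.
Qed.

(** One step of Lucas' theorem, splitting off the lowest binary digit so that later proofs can
    induct by halving. *)
Lemma odd_bin_half (i j : nat) :
  odd 'C(i, j) = (odd j ==> odd i) && odd 'C(i./2, j./2).
Proof.
rewrite -{1}[i]odd_double_half -{1}[j]odd_double_half.
have [E0 E1] := odd_bin_double i./2 j./2.
case: (odd i); case: (odd j); rewrite /= ?add1n ?add0n ?E0 ?E1 //.
  by rewrite binS oddD E0 E1.
(* Here [i] is odd and [j] even; Pascal's rule needs a nonzero lower index, so [j./2 = 0] is treated
   apart. *)
case: j./2 E0 => [|b] E0; first by rewrite !bin0.
have [_ Eb1] := odd_bin_double i./2 b.
by rewrite doubleS binS oddD -doubleS E0 Eb1 addbF.
Qed.

Lemma odd_bin_trans (j i k : nat) :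
  odd 'C(i, j) -> odd 'C(j, k) -> odd 'C(i, k).
Proof.
elim/ltn_ind: i j k => -[|i] IH j k; first by case: j.
rewrite !(odd_bin_half i.+1) (odd_bin_half j).
move=> /andP[ij Cij] /andP[jk Cjk]; apply/andP; split.
  by move: ij jk; case: (odd k); case: (odd j).
by apply: IH Cij Cjk; lia.
Qed.

(** Complementing [n] digits commutes with halving and negates the lowest digit, so the implication
    between lowest digits becomes its contrapositive. *)
Lemma odd_bin_compl (n i j : nat) : (i < 2 ^ n)%N -> (j < 2 ^ n)%N ->
  odd 'C(2 ^ n - j.+1, 2 ^ n - i.+1) = odd 'C(i, j).
Proof.
elim: n i j => [|n IH] i j; first by case: i j => [|i] [|j].
rewrite expnS => lti ltj.
have half_compl k : (k < 2 * 2 ^ n)%N ->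
    (2 * 2 ^ n - k.+1)./2 = (2 ^ n - k./2.+1)%N by lia.
have odd_compl k : (k < 2 * 2 ^ n)%N ->
    odd (2 * 2 ^ n - k.+1) = ~~ odd k by lia.
rewrite odd_bin_half [RHS]odd_bin_half !half_compl // !odd_compl //.
by rewrite implybNN IH //; lia.
Qed.

Lemma binary_pascal_mxE (m : nat) (i j : 'I_m) :
  binary_pascal_mx m i j = (odd 'C(i, j))%:R.
Proof. by rewrite mxE modn2 natz. Qed.

Lemma Q_mono (k m : nat) (a : k.-tuple 'I_m) :
  reflect {homo tnth a : i j / (i < j)%N} (a \in Q k m).
Proof.
have nthE (i : 'I_k) : nth 0%N [seq val x | x <- a] i = tnth a i.
  by rewrite (nth_map (tnth a i)) ?size_tuple // -tnth_nth.
rewrite inE; apply: (iffP idP) => [a_sorted i j ltij | a_mono].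
  rewrite -!nthE; apply: (sorted_ltn_nth ltn_trans) => //;
  by rewrite inE size_map size_tuple.
apply/(sortedP 0%N) => i; rewrite size_map size_tuple => lti.
have := a_mono (Ordinal (ltnW lti)) (Ordinal lti) (ltnSn i).
by rewrite -!nthE.
Qed.

(** Since [a] increases, entries above the diagonal are binomials with lower index exceeding the
    upper; transitivity is that of the digit order. *)
Lemma binary_pascal_submx_poset (k m : nat) (a : k.-tuple 'I_m) :
  a \in Q k m -> is_poset_mx (principal_submx (binary_pascal_mx m) a).
Proof.
move=> /Q_mono a_mono.
have E i j : principal_submx (binary_pascal_mx m) a i j
    = (odd 'C(tnth a i, tnth a j))%:R by rewrite mxE binary_pascal_mxE.
split=> [i j | | i | i j l].
- by rewrite E; case: odd; [right | left].
- by apply/is_trig_mxP => i j ltij; rewrite E bin_small // a_mono.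
- by rewrite E binn.
- rewrite !E; case: odd (@odd_bin_trans (tnth a j) (tnth a i) (tnth a l)) => //.
  by case: (odd 'C(tnth a j, _)) => // ->.
Qed.

Lemma dual_mxE (n : nat) (A : 'M[int]_n) (i j : 'I_n) :
  dual_mx A i j = A (rev_ord j) (rev_ord i).
Proof.
(* Column [j] of the right factor has its only 1 in row [rev_ord j], so one term survives; row [i]
   of the left factor is handled likewise. *)
rewrite mxE (bigD1 (rev_ord j)) //= big1 ?addr0 => [|l neq_l]; last first.
  by rewrite [X in _ * X]mxE -(inj_eq rev_ord_inj) rev_ordK eq_sym
    (negPf neq_l) mulr0.
rewrite !mxE rev_ordK eqxx mulr1 (bigD1 (rev_ord i)) //= big1 ?addr0.
  by rewrite !mxE eqxx mul1r.
by move=> l neq_l; rewrite !mxE (negPf neq_l) mul0r.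
Qed.

(** Reversing positions and complementing values each reverse the order, so together they preserve
    it. *)
Lemma rev_compl_Q (k m : nat) (a : k.-tuple 'I_m) :
  a \in Q k m -> rev_compl a \in Q k m.
Proof.
move=> /Q_mono a_mono; apply/Q_mono => i j ltij.
rewrite !tnth_mktuple /=.
have : (tnth a (rev_ord j) < tnth a (rev_ord i))%N.
  by apply: a_mono => /=; have := ltn_ord j; lia.
by have := ltn_ord (tnth a (rev_ord i)); lia.
Qed.

Theorem theorem5p1 (n : nat) (alpha : n.-tuple 'I_(2 ^ n)%N)
    (alphaQ : alpha \in Q n (2 ^ n)%N) :
  let P := binary_pascal_mx (2 ^ n)%N in
  let A := principal_submx P alpha in
  let beta := rev_compl alpha in
  [/\ beta \in Q n (2 ^ n)%N,
      dual_mx A = principal_submx P beta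
    & is_poset_mx (dual_mx A)].
Proof.
move=> P A beta.
have betaQ : beta \in Q n (2 ^ n)%N by exact: rev_compl_Q.
have dualA : dual_mx A = principal_submx P beta.
  apply/matrixP => i j.
  rewrite dual_mxE mxE [RHS]mxE !binary_pascal_mxE !tnth_mktuple /=.
  (* The flip swaps the two binomial arguments, exactly as complementation does. *)
  by rewrite odd_bin_compl.
by split=> //; rewrite dualA; exact: binary_pascal_submx_poset.
Qed.
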